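(* Let $(\varepsilon_n)_{n\ge1}$ be a totally periodic sequence in $\{1,-1\}$, let $(r_n)_{n\ge0}$ be the corresponding continued radical sequence, and let $r_\infty=\lim_{n\to\infty}r_n$. Then every limit point of the sequence $u_n=2^n(r_\infty-r_n)$ has the form $\alpha\pi$, where $\alpha$ is an algebraic number.
   Context: For a sequence $(\varepsilon_n)_{n\ge1}$ in $\{1,-1\}$, the continued radical sequence is $r_0=\sqrt2$ and $r_n=\sqrt{2+\varepsilon_1\sqrt{2+\cdots+\varepsilon_n\sqrt{2}}}$ for $n\ge1$ (nonnegative square roots); it converges. The sequence $(\varepsilon_n)$ is totally periodic if there is an integer $p\ge1$ such that $\varepsilon_{1+i+mp}=\varepsilon_{1+i}$ for all integers $m\ge0$ and all $i\in\{0,\dots,p-1\}$. A limit point of a real sequence is the limit of some convergent subsequence. *)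

(* Defs.v *)
From mathcomp Require Import all_boot all_order all_algebra.
From mathcomp Require Import all_classical all_reals all_analysis.

Set Implicit Arguments.
Unset Strict Implicit.
Unset Printing Implicit Defensive.

Import Order.TTheory GRing.Theory Num.Theory.
Import numFieldNormedType.Exports.

Local Open Scope classical_set_scope.
Local Open Scope ring_scope.

(* Sequences (eps_n)_{n >= 1} are functions on nat whose value at 0 is never
   used. *)

Definition sign_sequence (R : realType) (eps : nat -> R) : Prop :=
  forall n : nat, (1 <= n)%N -> eps n = 1 \/ eps n = -1.

(* foldr over [:: 1; ...; n] puts eps 1 outermost and eps n innermost. *)
Definition continued_radical (R : realType) (eps : nat -> R) (n : nat) : R :=
  foldr (fun i x => Num.sqrt (2 + eps i * x)) (Num.sqrt 2) (iota 1 n).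

Definition totally_periodic (T : Type) (eps : nat -> T) : Prop :=
  exists2 p : nat, (1 <= p)%N &
    forall m i : nat, (i < p)%N -> eps (1 + i + m * p)%N = eps (1 + i)%N.

(* Not the library's limit_point, which is about subsets of a topological space. *)
Definition subsequential_limit (R : realType) (u : nat -> R) (l : R) : Prop :=
  exists phi : nat -> nat,
    {homo phi : m n / (m < n)%N} /\ u (phi n) @[n --> \oo] --> l.

Definition algebraic_number (R : realType) (a : R) : Prop :=
  algebraicOver (ratr : rat -> R) a.

(* Main.v *)
Require Import Defs.
From mathcomp Require Import all_boot all_order all_algebra.
From mathcomp Require Import all_classical all_reals all_analysis.
From mathcomp Require Import ring lra.

Import Order.TTheory GRing.Theory Num.Theory.
Import numFieldNormedType.Exports.

Local Open Scope classical_set_scope.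
Local Open Scope ring_scope.

(** The substitution [z = 2 * cos (pi * y)] turns the nested radicals into
    affine dynamics.  By the half-angle formula, [z |-> sqrt (2 + s * z)]
    becomes one of the two contracting inverse branches of a tent map ([halving]), so
    [r n = 2 * cos (pi * x n)] where the angle [x n] is rational and is obtained
    from [1/4] by [n] halvings ([continued_radical_cos]).

    Undoing the halvings one at a time is an affine expanding iteration
    ([tent_orbit]), and periodicity of the signs gives it a rational point [xi]
    with a periodic orbit ([periodic_point_exists]).  Since [n] steps multiply
    differences by [+- 2 ^ n] and carry [x n] to [1/4], the scaled angle error
    [2 ^ n * (xi - x n)] equals exactly [+- (y n - 1/4)], where [y n] is the
    [n]-th orbit point of [xi]; hence it takes finitely many rational values
    ([finitely_many_angle_errors]).  Consequently [r] tends to [2 cos (pi xi)],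
    and a second-order expansion of the cosine shows that [u n] differs by a
    null sequence from [- 2 sin (pi xi) * c n * pi] with [c n] in that finite
    set.  A finite set is closed, so each limit point is itself one of these
    finitely many numbers; and [sin (pi xi)] is algebraic because [xi] is
    rational ([sin_pi_algebraic]). *)

(** * Tent-map dynamics of the angles *)

Section Angles.

Variable F : numFieldType.
Implicit Types (s x y : F) (e : nat -> F).

(** In units of [pi], the half-angle [y / 2] if [s = 1], and the half of the
    supplementary angle [(1 - y) / 2] if [s = -1]. *)
Definition halving s y : F := (1 - s) / 4 + s * y / 2.

Definition doubling s x : F := (1 - s) / 2 + 2 * s * x.

Fixpoint tent_orbit e x n : F :=
  if n is m.+1 then doubling (e n) (tent_orbit e x m) else x.

Definition sign_product e n : F := \prod_(1 <= i < n.+1) e i.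

(** The angle whose doubled cosine is the [n]-th radical; [1/4] stands for the
    innermost [sqrt 2 = 2 * cos (pi / 4)]. *)
Definition radical_angle e n : F :=
  foldr (fun i => halving (e i)) 4^-1 (iota 1 n).

Definition is_sign s := s = 1 \/ s = -1.

Lemma halvingK s y : is_sign s -> doubling s (halving s y) = y.
Proof. by rewrite /doubling /halving => -[->|->]; field. Qed.

Lemma is_sign_prod e n :
  (forall i, (1 <= i)%N -> is_sign (e i)) -> is_sign (sign_product e n).
Proof.
move=> e_sign; rewrite /sign_product; elim: n => [|n IHn].
  by rewrite big_geq //; left.
rewrite (big_nat_recr n.+1) //=.
rewrite /is_sign; case: (e_sign n.+1 isT) => ->; case: IHn => ->;
  by rewrite ?mulr1 ?mulrN1 ?opprK; auto.
Qed.

Lemma foldr_halvingK e n y : (forall i, (1 <= i)%N -> is_sign (e i)) ->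
  tent_orbit e (foldr (fun i => halving (e i)) y (iota 1 n)) n = y.
Proof.
move=> e_sign; elim: n y => // n IHn y.
rewrite -[in iota 1 _](addn1 n) iotaD foldr_cat /= add1n IHn halvingK //.
exact: e_sign.
Qed.

Lemma tent_orbit_sub e x y n :
  tent_orbit e x n - tent_orbit e y n = sign_product e n * 2 ^+ n * (x - y).
Proof.
rewrite /sign_product; elim: n => [|n IHn].
  by rewrite big_geq //= expr0 !mul1r.
rewrite (big_nat_recr n.+1) //= exprS /doubling.
transitivity (2 * e n.+1 * (tent_orbit e x n - tent_orbit e y n)); first ring.
by rewrite IHn; ring.
Qed.

(** The composite of [p] doublings is affine with slope [+- 2 ^ p], which is
    not [1], so it has a fixed point; it lies in the field of the signs, which
    is why rational signs yield a rational angle. *)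
Lemma periodic_point_exists e p : (1 <= p)%N ->
  (forall i, (1 <= i)%N -> is_sign (e i)) ->
  (forall m i, (i < p)%N -> e (1 + i + m * p)%N = e (1 + i)%N) ->
  exists x, forall n, tent_orbit e x (n + p) = tent_orbit e x n.
Proof.
move=> p_gt0 e_sign e_per.
have slope_neq1 : 1 - sign_product e p * 2 ^+ p != 0.
  rewrite subr_eq0; apply/eqP => /(congr1 Num.norm).
  have -> : `|sign_product e p * 2 ^+ p| = 2 ^+ p.
    rewrite normrM normrX normr_nat.
    by have [] := is_sign_prod e p e_sign => ->; rewrite ?normrN normr1 mul1r.
  move=> one_pow; have : (1 : F) < 2 ^+ p by rewrite exprn_egt1 ?ltr1n -?lt0n.
  by rewrite -one_pow normr1 ltxx.
exists (tent_orbit e 0 p / (1 - sign_product e p * 2 ^+ p)).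
elim=> [|n IHn]; last first.
  rewrite addSn /= IHn; congr doubling.
  have e_mod k : e k.+1 = e (1 + k %% p)%N.
    rewrite -(e_per (k %/ p)%N) ?ltn_mod // -addnA.
    by rewrite [(k %% p + _)%N]addnC -divn_eq.
  by rewrite e_mod modnDr -e_mod.
rewrite add0n /=; set x := _ / _.
have := tent_orbit_sub e x 0 p; rewrite subr0 => /eqP.
by rewrite subr_eq => /eqP ->; rewrite /x; field.
Qed.

(** Applying [n] doublings to both [x] and the [n]-th radical angle compares
    the orbit of [x] with [1/4], hence the exact value. *)
Lemma angle_error e x n : (forall i, (1 <= i)%N -> is_sign (e i)) ->
  2 ^+ n * (x - radical_angle e n)
    = sign_product e n * (tent_orbit e x n - 4^-1).
Proof.
move=> e_sign; rewrite -[in RHS](foldr_halvingK e n 4^-1 e_sign).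
rewrite tent_orbit_sub -/(radical_angle e n).
have [] := is_sign_prod e n e_sign => ->; ring.
Qed.

Lemma finitely_many_angle_errors e x p : (1 <= p)%N ->
  (forall i, (1 <= i)%N -> is_sign (e i)) ->
  (forall n, tent_orbit e x (n + p) = tent_orbit e x n) ->
  exists c : seq F, forall n, 2 ^+ n * (x - radical_angle e n) \in c.
Proof.
move=> p_gt0 e_sign orbit_per.
exists [seq s * (tent_orbit e x i - 4^-1) | s <- [:: 1; -1], i <- iota 0 p].
move=> n.
rewrite angle_error //.
have -> : tent_orbit e x n = tent_orbit e x (n %% p).
  rewrite {1}(divn_eq n p) addnC; elim: (n %/ p)%N => [|m IHm].
    by rewrite mul0n addn0.
  by rewrite mulSnr addnA orbit_per.
apply/allpairsP; exists (sign_product e n, (n %% p)%N); split=> //=.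
  by have [] := is_sign_prod e n e_sign => ->; rewrite !inE eqxx ?orbT.
by rewrite mem_iota add0n ltn_mod.
Qed.

End Angles.

Lemma finite_bounded (F : numDomainType) (c : seq F) :
  exists C, forall x, x \in c -> `|x| <= C.
Proof.
exists (\sum_(x <- c) `|x|) => x xc.
by rewrite (big_rem x) //= lerDl sumr_ge0.
Qed.

(** * Radicals as cosines *)

Section Cosines.

Variable R : realType.
Implicit Types (a b t y : R).

(** The bounds on [y] keep the halved angle between [0] and [pi / 2], where
    the cosine is the nonnegative square root. *)
Lemma sqrt_half_angle s y : is_sign R s -> 0 <= y <= 1 ->
  Num.sqrt (2 + s * (2 * cos (pi * y))) = 2 * cos (pi * halving R s y).
Proof.
move=> s_sign /andP[y_ge0 y_le1].
have pi_pos : 0 < pi :> R := pi_gt0 R.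
have half_ge0 : 0 <= halving R s y <= 2^-1.
  by rewrite /halving; case: s_sign => ->; apply/andP; split; lra.
have cos_ge0 : 0 <= cos (pi * halving R s y).
  apply: cos_ge0_pihalf; case/andP: half_ge0 => h0 h1.
  by apply/andP; split; nra.
have cos_double : cos ((pi * halving R s y) *+ 2) = s * cos (pi * y).
  rewrite /halving; case: s_sign => ->.
    by rewrite (_ : _ *+ 2 = pi * y) ?mul1r //; field.
  rewrite (_ : _ *+ 2 = - (pi * y) + pi); last by field.
  by rewrite cosDpi cosN mulN1r.
rewrite cos_mulr2n in cos_double.
have -> : 2 + s * (2 * cos (pi * y)) = (2 * cos (pi * halving R s y)) ^+ 2.
  by rewrite mulrCA -cos_double; ring.
by rewrite sqrtr_sqr ger0_norm // mulr_ge0.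
Qed.

Lemma continued_radical_cos (eps : nat -> R) n :
  (forall i, (1 <= i)%N -> is_sign R (eps i)) ->
  continued_radical eps n = 2 * cos (pi * radical_angle R eps n).
Proof.
move=> eps_sign; rewrite /continued_radical /radical_angle.
have -> : Num.sqrt 2 = 2 * cos (pi * 4^-1) :> R.
  have := @sqrt_half_angle 1 2^-1 (or_introl erefl).
  rewrite cos_pihalf !mulr0 addr0 => ->; last lra.
  by congr (_ * cos (_ * _)); rewrite /halving; field.
have : all (leq 1) (iota 1 n).
  by apply/allP => i; rewrite mem_iota => /andP[].
(* Halving is applied to angles in [0, pi] only, so the bounds are carried. *)
set radical := foldr _ _; set angle := foldr _ _.
move=> iota_ge1.
suff [] : radical (iota 1 n) = 2 * cos (pi * angle (iota 1 n))
    /\ 0 <= angle (iota 1 n) <= 1 by [].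
elim: (iota 1 n) iota_ge1 => [_|i l IHl /= /andP[/eps_sign i_sign /IHl]].
  by split=> //=; lra.
rewrite /radical /angle /= => -[-> bounds].
split; first exact: sqrt_half_angle.
case/andP: bounds => b0 b1; rewrite /halving.
by case: i_sign => ->; apply/andP; split; lra.
Qed.

(** * Second-order expansion of the cosine *)

(** The intermediate point is located by its distance to [a], so that [a] and
    [b] may come in either order. *)
Lemma mean_value_norm (f df : R -> R) a b :
  (forall x : R, is_derive x 1 f (df x)) ->
  exists2 c, `|c - a| <= `|b - a| & f b - f a = df c * (b - a).
Proof.
move=> f_der.
have f_cont : continuous f.
  move=> x; apply: differentiable_continuous; apply/derivable1_diffP.
  by have [] := f_der x.
have [ab|/ltW ba] := leP a b.
  have [c] := MVT_segment ab (fun x _ => f_der x) (continuous_subspaceT f_cont).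
  rewrite in_itv /= => /andP[ac cb] E; exists c => //.
  by rewrite !ger0_norm ?subr_ge0 // lerD2r.
have [c] := MVT_segment ba (fun x _ => f_der x) (continuous_subspaceT f_cont).
rewrite in_itv /= => /andP[bc ca] E; exists c; last first.
  by rewrite -opprB E -mulrN opprB.
by rewrite !ler0_norm ?subr_le0 // !opprB lerD2l lerN2.
Qed.

Lemma cos_expansion a b :
  `|cos b - cos a + sin a * (b - a)| <= `|b - a| ^+ 2.
Proof.
have [c ca ->] := mean_value_norm cos (fun x => - sin x) a b (@is_derive_cos R).
have [d _ sinE] := mean_value_norm sin cos a c (@is_derive_sin R).
have -> : - sin c * (b - a) + sin a * (b - a) = - (sin c - sin a) * (b - a).
  by ring.
rewrite sinE normrM normrN normrM expr2 ler_wpM2r //.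
by rewrite (le_trans _ ca) // ler_piMl // cos_max.
Qed.

(** * Algebraicity of sines of rational multiples of [pi] *)

(** Chebyshev polynomials in the normalization [2 cos t |-> 2 cos (n t)]. *)
Fixpoint dickson (n : nat) : {poly rat} :=
  if n is k.+1 then
    if k is m.+1 then 'X * dickson k - dickson m else 'X
  else 2%:P.

Arguments dickson : simpl never.

Lemma dickson_rec n : dickson n.+2 = 'X * dickson n.+1 - dickson n.
Proof. by []. Qed.

Lemma size_dickson n : size (dickson n) = n.+1.
Proof.
elim/ltn_ind: n => -[|[|n]] IH; first by rewrite size_polyC.
  by rewrite size_polyX.
have nz : dickson n.+1 != 0 by rewrite -size_poly_eq0 IH.
by rewrite dickson_rec mulrC size_polyDl size_mulX // ?size_polyN !IH.
Qed.

Lemma dickson_cos n t :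
  (map_poly ratr (dickson n)).[2 * cos t] = 2 * cos (t *+ n) :> R.
Proof.
elim/ltn_ind: n => -[|[|n]] IH.
- by rewrite mulr0n cos0 map_polyC hornerC /= ratr_nat mulr1.
- by rewrite map_polyX hornerX mulr1n.
rewrite dickson_rec rmorphB rmorphM /= map_polyX.
rewrite hornerD hornerN hornerM hornerX.
rewrite !IH //.
have -> : t *+ n.+2 = t *+ n.+1 + t by rewrite mulrSr.
have -> : t *+ n = t *+ n.+1 - t by rewrite mulrSr addrK.
by rewrite cosB cosD; ring.
Qed.

(** With [b] the denominator of [q], the angle [pi q] taken [2 b] times is a
    multiple of [2 pi], so [2 cos (pi q)] solves [dickson (2 b) = 2]. *)
Lemma cos_pi_algebraic (q : rat) : algebraic_number (cos (pi * ratr q : R)).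
Proof.
have two_alg : algebraic_number (2 : R).
  by rewrite /algebraic_number -(ratr_nat R 2); apply: algebraic_id.
suff alg : algebraic_number (2 * cos (pi * ratr q : R)).
  by have := algebraic_div alg two_alg; rewrite mulrC mulKf.
pose n := (2 * `|denq q|)%N.
have n_gt0 : (0 < n)%N by rewrite muln_gt0 absz_gt0 denq_neq0.
exists (dickson n - 2%:P).
  by rewrite -size_poly_eq0 size_polyDl ?size_polyN size_dickson // size_polyC.
rewrite /root rmorphB /= map_polyC /= ratr_nat.
rewrite hornerD hornerN hornerC dickson_cos.
suff -> : cos (pi * ratr q *+ n) = 1 :> R by rewrite mulr1 subrr.
rewrite -cos_norm -[RHS](cos0 R) -(periodicn (@cosD2pi R) `|numq q| 0) add0r.
congr cos.
rewrite normrMn normrM (ger0_norm (pi_ge0 R)) -mulrnA.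
rewrite -[LHS]mulr_natr -[RHS]mulr_natr -mulrA; congr (_ * _).
rewrite !natrM mulrCA; congr (_ * _).
have -> : ratr q = (numq q)%:~R / (denq q)%:~R :> R by [].
rewrite normrM normfV !natr_absz !intr_norm mulfVK //.
by rewrite normr_eq0 intr_eq0 denq_neq0.
Qed.

Lemma sin_pi_algebraic (q : rat) : algebraic_number (sin (pi * ratr q : R)).
Proof.
have := cos_pi_algebraic (q - 2^-1).
by rewrite rmorphB fmorphV rmorph_nat mulrBr cosBpihalf.
Qed.

End Cosines.

(** * Limit points *)

Lemma cvg_dyadic_error (R : realType) (f : nat -> R) (l K : R) :
  (forall n, `|f n - l| <= K / 2 ^+ n) -> f n @[n --> \oo] --> l.
Proof.
move=> f_le; apply/subr_cvg0/norm_cvg0P.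
have K_cvg : K / 2 ^+ n @[n --> \oo] --> 0.
  rewrite (_ : (fun n => _) = geometric K 2^-1); last first.
    by apply/funext => n /=; rewrite exprVn.
  by apply: cvg_geometric; rewrite ger0_norm ?invr_ge0 // invf_lt1 // ltr1n.
apply: (squeeze_cvgr _ (cvg_cst 0) K_cvg).
by apply: nearW => n; rewrite normr_ge0 f_le.
Qed.

Lemma ratr_radical_angle (R : realType) (e : nat -> rat) n :
  ratr (radical_angle rat e n) = radical_angle R (ratr \o e) n.
Proof.
rewrite /radical_angle; elim: (iota 1 n) => /= [|i l <-].
  by rewrite fmorphV rmorph_nat.
by rewrite /halving rmorphD !rmorphM !fmorphV !rmorph_nat rmorphB rmorph1.
Qed.

(** The angles are kept rational because the algebraicity of [sin (pi xi)]
    rests on [xi] being rational. *)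
Lemma continued_radical_ratr_cos (R : realType) (eps : nat -> R)
    (e : nat -> rat) n :
  (forall i, (1 <= i)%N -> is_sign rat (e i)) ->
  (forall i, (1 <= i)%N -> eps i = ratr (e i)) ->
  continued_radical eps n = 2 * cos (pi * ratr (radical_angle rat e n)).
Proof.
move=> e_sign epsE; rewrite ratr_radical_angle -continued_radical_cos;
  last first.
  move=> i /e_sign [] /= ->; rewrite ?rmorphN rmorph1; by [left|right].
rewrite /continued_radical; have : all (leq 1) (iota 1 n).
  by apply/allP => i; rewrite mem_iota => /andP[].
by elim: (iota 1 n) => //= i l IHl /andP[i_ge1 /IHl ->]; rewrite epsE.
Qed.

Theorem corollary6p1 (R : realType) (eps : nat -> R)
    (eps_sign : sign_sequence eps) (eps_periodic : totally_periodic eps) :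
  let r := continued_radical eps in
  let r_oo : R := limn r in
  let u := fun n : nat => 2 ^+ n * (r_oo - r n) in
  forall l : R, subsequential_limit u l ->
    exists2 alpha : R, algebraic_number alpha & l = alpha * pi.
Proof.
move=> r r_oo u l [phi [phi_incr u_cvg]].
have [p p_gt0 eps_per] := eps_periodic.
pose e n : rat := if eps n == 1 then 1 else -1.
have e_sign i : (1 <= i)%N -> is_sign rat (e i).
  by rewrite /e; case: ifP => _; [left|right].
have epsE i : (1 <= i)%N -> eps i = ratr (e i).
  move=> /eps_sign; rewrite /e; case: eqP => [->|_ []// ->];
    by rewrite ?rmorphN rmorph1.
have e_per m i : (i < p)%N -> e (1 + i + m * p)%N = e (1 + i)%N.
  by move=> ip; rewrite /e eps_per.
have [xi xi_per] := periodic_point_exists rat e p p_gt0 e_sign e_per.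
have [c delta_c] := finitely_many_angle_errors rat e xi p p_gt0 e_sign xi_per.
pose delta n : rat := 2 ^+ n * (xi - radical_angle rat e n).
have [C delta_le] := finite_bounded rat c.
pose a : R := pi * ratr xi.
pose b n : R := pi * ratr (radical_angle rat e n).
pose M : R := pi * ratr C.
have rE n : r n = 2 * cos (b n) by apply: continued_radical_ratr_cos.
have b_sub n : b n - a = - (pi * ratr (delta n)) / 2 ^+ n.
  rewrite /b /a /delta rmorphM rmorphXn /= rmorph_nat rmorphB.
  by field; rewrite expf_neq0.
have b_le n : `|b n - a| <= M / 2 ^+ n.
  rewrite b_sub mulNr normrN 2!normrM (ger0_norm (pi_ge0 R)).
  rewrite normfV normrX normr_nat.
  rewrite ler_wpM2r ?invr_ge0 ?exprn_ge0 // ler_wpM2l ?pi_ge0 //.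
  by rewrite -ratr_norm ler_rat; apply: delta_le (delta_c n).
(* By continuity of the cosine, since the angles [b n] tend to [a]. *)
have r_ooE : r_oo = 2 * cos a.
  apply: cvg_lim => //.
  rewrite (_ : r = fun n => 2 * cos (b n)); last exact/funext.
  apply: cvgM; first exact: cvg_cst.
  apply: continuous_cvg; first exact: continuous_cos.
  exact: cvg_dyadic_error b_le.
(* First-order part of [u n]; the quadratic remainder of the cosine is of order
   [4 ^- n], hence still negligible after multiplication by [2 ^+ n]. *)
pose limit_value (d : rat) : R := - (2 * sin a * ratr d) * pi.
have u_error n : `|u n - limit_value (delta n)| <= 2 * M ^+ 2 / 2 ^+ n.
  have -> : u n - limit_value (delta n)
      = - (2 * 2 ^+ n) * (cos (b n) - cos a + sin a * (b n - a)).
    rewrite /u r_ooE rE b_sub /limit_value.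
    by field; rewrite expf_neq0.
  have pow_ge0 : 0 <= 2 * 2 ^+ n :> R by rewrite mulr_ge0 ?exprn_ge0.
  rewrite normrM normrN (ger0_norm pow_ge0).
  have -> : 2 * M ^+ 2 / 2 ^+ n = 2 * 2 ^+ n * (M / 2 ^+ n) ^+ 2 :> R.
    by field; rewrite expf_neq0.
  rewrite ler_wpM2l //.
  rewrite (le_trans (cos_expansion _ _ _)) // lerXn2r ?nnegrE //.
  by rewrite (le_trans _ (b_le n)).
have phi_ge n : (n <= phi n)%N.
  by elim: n => // n IHn; rewrite (leq_ltn_trans IHn) // phi_incr.
have value_cvg : limit_value (delta (phi n)) @[n --> \oo] --> l.
  rewrite -[l]subr0.
  pose error n := u n - limit_value (delta n).
  rewrite (_ : (fun n => _) = fun n => u (phi n) - error (phi n)); last first.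
    by apply/funext => n; rewrite subKr.
  apply: cvgB => //; apply: (@cvg_dyadic_error _ _ _ (2 * M ^+ 2)) => n.
  rewrite subr0 (le_trans (u_error _)) // ler_wpM2l //.
    by rewrite mulr_ge0 // sqr_ge0.
  by rewrite lef_pV2 ?posrE ?exprn_gt0 // ler_weXn2l ?ler1n.
(* The values approaching [l] lie in a finite, hence closed, set. *)
have [d _ <-] : (limit_value @` [set` c]) l.
  apply: (closed_cvg _ _ _ _ value_cvg).
    apply: (accessible_finite_set_closed.1 _ _ (finite_image _ (finite_seq c))).
    exact/hausdorff_accessible/norm_hausdorff.
  by apply: nearW => n; exists (delta (phi n)) => //=; apply: delta_c.
exists (- (2 * sin a * ratr d)) => //.
apply/algebraic_opp/algebraic_mul; last exact: algebraic_id.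
apply: algebraic_mul; last exact: sin_pi_algebraic.
by rewrite -(ratr_nat R 2); apply: algebraic_id.
Qed.
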